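(* Let $\mathcal{G}=(G_1,\dots,G_L)$ be a temporal graph with $n$ vertices, let $k$ be an integer with $0<k<n$, and suppose the lifetime satisfies $L\geq kn^2$. Let $s$ be any given starting vertex. If for every $t\leq L$ the snapshot $G_t$ (is connected and) has diameter less than or equal to $k$, then there exists an exploration of $\mathcal{G}$ starting at $s$ that traverses less than $kn$ edges.
   Context: A temporal graph $\mathcal{G}$ with (finite) vertex set $V$, $|V|=n$, and lifetime $L$ is a sequence $(G_1,\dots,G_L)$ of static undirected graphs $G_i=(V,E_i)$; $G_i$ is the snapshot at time step $i$. All temporal graphs are assumed constantly connected: every $G_i$ is connected. A (strict) journey from $u$ to $v$ is a sequence $((v_0,v_1),t_1),((v_1,v_2),t_2),\dots,((v_{l-1},v_l),t_l)$ with $v_0=u$, $v_l=v$, $1\le t_1<t_2<\dots<t_l\le L$ (the time steps need not be consecutive) and $\{v_{i-1},v_i\}\in E_{t_i}$ for all $i$; thus at each time step an agent either stays on its vertex or traverses one edge of the current snapshot. The number of edges traversed (the length) is $l$, counted with multiplicity; $l=0$ is allowed if $u=v$. The journey visits the vertices $v_0,\dots,v_l$. An exploration starting at $s$ is a strict journey with $v_0=s$ that visits all vertices of $V$. *)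

(* Defs.v *)
(* Mathematical Components *)
From mathcomp Require Import all_boot.

Set Implicit Arguments.
Unset Strict Implicit.
Unset Printing Implicit Defensive.

Record sgraph (V : finType) := SGraph {
  edge : rel V;
  edge_sym : symmetric edge;
  edge_irrefl : irreflexive edge
}.

Definition connected (V : finType) (G : sgraph V) : Prop :=
  forall x y : V, connect (edge G) x y.

Definition has_walk (V : finType) (G : sgraph V) (x y : V) (m : nat) : bool :=
  [exists p : m.-tuple V, path (edge G) x p && (last x p == y)].

(* The least length of a walk from x to y. Distances between connected
   vertices are < #|V|, so the search range is large enough; the value is #|V|
   when y is not reachable from x. *)
Definition dist (V : finType) (G : sgraph V) (x y : V) : nat :=
  find (has_walk G x y) (iota 0 #|V|).

Definition diameter (V : finType) (G : sgraph V) : nat :=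
  \max_(x : V) \max_(y : V) dist G x y.

(* The ordinal i : 'I_L stands for the time step i + 1 of {1, ..., L}. *)
Definition temporal_graph (V : finType) (L : nat) := 'I_L -> sgraph V.

Definition constantly_connected (V : finType) (L : nat)
    (G : temporal_graph V L) : Prop :=
  forall t : 'I_L, connected (G t).

(* An element ((x, y), t) is the traversal of {x, y} from x to y at time t. *)
Definition steps (V : finType) (L : nat) := seq ((V * V) * 'I_L).

Definition sources (V : finType) (L : nat) (J : steps V L) : seq V :=
  unzip1 (unzip1 J).

Definition targets (V : finType) (L : nat) (J : steps V L) : seq V :=
  unzip2 (unzip1 J).

(* For targets v_1, ..., v_l, the second conjunct says that the sources are
   u, v_1, ..., v_(l-1). *)
Definition journey (V : finType) (L : nat) (G : temporal_graph V L)
    (u v : V) (J : steps V L) : bool :=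
  [&& all (fun a => edge (G a.2) a.1.1 a.1.2) J,
      sources J == belast u (targets J),
      last u (targets J) == v
    & sorted ltn [seq val a.2 | a <- J]].

Definition visited (V : finType) (L : nat) (u : V) (J : steps V L) : seq V :=
  u :: targets J.

Definition exploration (V : finType) (L : nat) (G : temporal_graph V L)
    (s : V) (J : steps V L) : Prop :=
  (exists v : V, journey G s v J) /\ (forall x : V, x \in visited s J).

(* Main.v *)
Require Import Defs.
From mathcomp Require Import all_boot.
From mathcomp Require Import zify.

Set Implicit Arguments.
Unset Strict Implicit.
Unset Printing Implicit Defensive.

(** From any vertex [u], any vertex [v] can be reached within [k * n] steps
    using at most [k] edges: let [d x <= k + 1] bound the number of edges needed
    to reach [x] so far ([k + 1] standing for "not reached"). While
    [d v = k + 1], a path from [u] to [v] with at most [k] edges in the current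
    snapshot has an edge [yz] with [d z >= d y + 2], so [d z] can be lowered to
    [d y + 1 >= 1]. This lowers the sum of the [d x - 1], which is initially at
    most [k * n]. Visiting the [n - 1] vertices other than [s] one after the
    other in this way gives the exploration. *)

(** Otherwise [d] would grow by at most one per edge, ending at no more than [d x + size p]. *)
Lemma path_jump (T : Type) (e : rel T) (d : T -> nat) (x : T) (p : seq T) :
  path e x p -> d x + size p < d (last x p) ->
  exists y z, e y z /\ (d y).+1 < d z.
Proof.
elim: p x => [|y p IHp] x /=; first by lia.
move=> /andP[exy ep] dlt; have [|dy] := ltnP (d x).+1 (d y); first by exists x, y.
by apply: IHp ep _; lia.
Qed.

(** A failed search makes [dist] return [#|V|], so a value at most [k < #|V|] comes from a walk that
    exists. *)
Lemma diameter_walk (V : finType) (G : sgraph V) (k : nat) (x y : V) :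
  diameter G <= k < #|V| ->
  exists p, [/\ path (edge G) x p, last x p = y & size p <= k].
Proof.
move=> /andP[diamG ltkV].
have dist_le : dist G x y <= k.
  apply: leq_trans diamG; rewrite /diameter.
  apply: leq_trans (leq_bigmax (F := fun x => \max_y dist G x y) x).
  exact: (leq_bigmax (F := dist G x)).
have lt_dist := leq_ltn_trans dist_le ltkV.
have hasW : has (has_walk G x y) (iota 0 #|V|) by rewrite has_find size_iota.
have := nth_find 0 hasW; rewrite -/(dist G x y) nth_iota // add0n.
case/existsP=> p /andP[Gp /eqP lastp].
by exists p; rewrite size_tuple.
Qed.

Section Journeys.
Variables (V : finType) (L : nat) (G : temporal_graph V L).
Implicit Types (u v w x y z : V) (J : steps V L).

Definition after (a : nat) J := all (fun e : V * V * 'I_L => a <= e.2) J.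
Definition before (b : nat) J := all (fun e : V * V * 'I_L => e.2 < b) J.

Lemma after_le (a b : nat) J : a <= b -> after b J -> after a J.
Proof. by move=> leab; apply: sub_all => e; apply: leq_trans. Qed.

Lemma before_le (a b : nat) J : a <= b -> before a J -> before b J.
Proof. by move=> leab; apply: sub_all => e /leq_trans; apply. Qed.

Lemma journey_nil u : journey G u u [::].
Proof. by rewrite /journey /= !eqxx. Qed.

Lemma journey_edge (t : 'I_L) x y :
  edge (G t) x y -> journey G x y [:: ((x, y), t)].
Proof. by move=> Gxy; rewrite /journey /= Gxy !eqxx. Qed.

Lemma targets_cat J1 J2 : targets (J1 ++ J2) = targets J1 ++ targets J2.
Proof. by rewrite /targets /unzip1 /unzip2 !map_cat. Qed.

Lemma sources_cat J1 J2 : sources (J1 ++ J2) = sources J1 ++ sources J2.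
Proof. by rewrite /sources /unzip1 !map_cat. Qed.

Lemma journey_last {u v J} : journey G u v J -> last u (targets J) = v.
Proof. by case/and4P=> _ _ /eqP. Qed.

(** Cutting at [b] puts every time of [J1] strictly below every time of [J2], so the times stay
    strictly increasing. *)
Lemma journey_cat (b : nat) u v w J1 J2 :
  journey G u v J1 -> before b J1 -> journey G v w J2 -> after b J2 ->
  journey G u w (J1 ++ J2).
Proof.
case/and4P=> G1 /eqP S1 /eqP T1 O1 B1 /and4P[G2 /eqP S2 /eqP T2 O2] A2.
rewrite /journey all_cat G1 G2 sources_cat targets_cat belast_cat last_cat.
rewrite S1 T1 S2 T2 !eqxx map_cat /=.
move: O1 O2; rewrite !(sorted_pairwise ltn_trans) pairwise_cat => -> ->.
rewrite !andbT; apply/allrelP => t1 t2 /mapP[e1 e1J ->] /mapP[e2 e2J ->].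
exact: leq_trans (allP B1 _ e1J) (allP A2 _ e2J).
Qed.

Lemma short_journey (k a : nat) u v :
  0 < k < #|V| -> (forall t, diameter (G t) <= k) -> a + k * #|V| <= L ->
  exists J, [/\ journey G u v J, after a J, before (a + k * #|V|) J
              & size J <= k].
Proof.
move=> /andP[k_gt0 ltkV] diamG leL.
pose reach T m x := exists J,
  [/\ journey G u x J, after a J, before (a + T) J & size J = m].
have reach_nil T : reach T 0 u by exists [::]; split=> //; apply: journey_nil.
have reach_le T T' m x : T <= T' -> reach T m x -> reach T' m x.
  move=> leT [J [GJ aJ bJ sJ]]; exists J; split=> //.
  by apply: before_le bJ; rewrite leq_add2l.
suff [m lemk [J [GJ aJ bJ sJ]]] : exists2 m, m <= k & reach (k * #|V|) m v.
  by exists J; rewrite sJ.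
have [<-|neq_uv] := eqVneq u v; first by exists 0.
have main T : T <= k * #|V| ->
  (exists2 m, m <= k & reach T m v) \/
  exists d : V -> nat,
    [/\ d u = 0, d v = k.+1, forall x, d x <= k -> reach T (d x) x
      & T + \sum_x (d x).-1 <= k * #|V|].
  elim: T => [|T IHT] leT.
    (* Only [u] counts as reached; its term in the sum is 0, all others are [k]. *)
    right; exists (fun x => if x == u then 0 else k.+1).
    rewrite eqxx eq_sym (negbTE neq_uv); split=> // [x|].
      by case: eqP => [-> _|]; [exact: reach_nil | rewrite ltnn].
    rewrite add0n mulnC -sum_nat_const; apply: leq_sum => x _.
    by case: ifP.
  have {IHT} [[m lemk rT]|[d [du dv rT sT]]] := IHT (ltnW leT).
    by left; exists m => //; apply: reach_le rT.
  have ltTL : a + T < L by lia.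
  pose t := Ordinal ltTL.
  have [|p [Gp lastp lepk]] := @diameter_walk V (G t) k u v.
    by rewrite diamG.
  (* Capping [d] keeps the jump away from vertices not yet reached. *)
  have [|y [z [Gyz ltyz]]] := @path_jump _ _ (fun x => minn (d x) k.+1) _ _ Gp.
    by rewrite lastp du dv; lia.
  have lt_dy : (d y).+1 < d z by lia.
  (* A jump under the cap [k.+1] forces [d y < k], so [y] has a journey that the edge at time
     [a + T] extends to [z]. *)
  have le_dy : d y < k by lia.
  have rz : reach T.+1 (d y).+1 z.
    have [J [GJ aJ bJ sJ]] := rT y (ltnW le_dy).
    exists (J ++ [:: ((y, z), t)]); split.
    - by apply: journey_cat GJ bJ (journey_edge Gyz) _; rewrite /after /= leqnn.
    - by rewrite /after all_cat [all _ J]aJ /= leq_addr.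
    - rewrite /before all_cat /= addnS ltnS leqnn !andbT.
      by apply: before_le bJ.
    - by rewrite size_cat sJ addn1.
  (* The invariant keeps [d v = k.+1], so reaching [v] ends the search. *)
  have [eq_zv|neq_zv] := eqVneq z v.
    by left; exists (d y).+1; rewrite -?eq_zv.
  right; exists (fun x => if x == z then (d y).+1 else d x); split.
  - by case: eqP => // eq_uz; rewrite -eq_uz du in lt_dy.
  - by rewrite eq_sym (negbTE neq_zv).
  - move=> x; case: eqP => [-> //|_ ledx].
    exact: reach_le (leqnSn _) (rT x ledx).
  (* The term of [z] drops from [(d z).-1] to [d y], by at least one, which pays for the extra time
     step. *)
  rewrite (bigD1 z) //= eqxx; rewrite (bigD1 z) //= in sT.
  rewrite (eq_bigr (fun x => (d x).-1)); first by lia.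
  by move=> x /negbTE ->.
(* After [k * #|V|] steps the sum would have to be 0, but [v] alone contributes [k > 0]. *)
have [//|[d [_ dv _]]] := main _ (leqnn _).
by rewrite (bigD1 v) //= dv; lia.
Qed.

(** Induction on [r]: each target gets its own window of [k * #|V|] time steps, entered at the
    vertex where the preceding journey ended. *)
Lemma short_tour (k a : nat) u (r : seq V) :
  0 < k < #|V| -> (forall t, diameter (G t) <= k) ->
  a + size r * (k * #|V|) <= L ->
  exists v J, [/\ journey G u v J, after a J, {subset r <= visited u J}
                & size J <= size r * k].
Proof.
move=> kP diamG; elim: r u a => [|x r IHr] u a /=.
  by exists u, [::]; split=> //; apply: journey_nil.
rewrite mulSn addnA => leL.
have [|J1 [G1 A1 B1 S1]] := @short_journey k a u x kP diamG.
  exact: leq_trans (leq_addr _ _) leL.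
have [v [J2 [G2 A2 sub2 S2]]] := IHr x _ leL.
exists v, (J1 ++ J2); split.
- exact: journey_cat G1 B1 G2 A2.
- by rewrite /after all_cat [all _ J1]A1; apply: after_le A2; apply: leq_addr.
- have x1 : x \in u :: targets J1 by rewrite -(journey_last G1) mem_last.
  rewrite /visited targets_cat -cat_cons => y; rewrite inE mem_cat.
  case/predU1P=> [->|/sub2]; first by rewrite x1.
  by rewrite inE => /predU1P[->|->]; rewrite ?x1 ?orbT.
- by rewrite size_cat mulSn leq_add.
Qed.

End Journeys.

Theorem theorem13 (V : finType) (L : nat) (G : temporal_graph V L) (k : nat)
    (s : V) :
  constantly_connected G ->
  0 < k < #|V| ->
  k * #|V| ^ 2 <= L ->
  (forall t : 'I_L, diameter (G t) <= k) ->
  exists J : steps V L, exploration G s J /\ size J < k * #|V|.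
Proof.
move=> _ kP leL diamG; have /andP[k_gt0 ltkV] := kP.
(* Since [s] is visited at the start, only [#|V|.-1] targets remain; this makes the edge bound
   strict. *)
have size_r : size (rem s (enum V)) = #|V|.-1.
  by rewrite size_rem ?mem_enum // -cardE.
have [|v [J [GJ _ subJ sJ]]] := @short_tour _ _ G k 0 s (rem s (enum V)) kP diamG.
  rewrite size_r add0n mulnCA; apply: leq_trans leL.
  by rewrite -mulnn !leq_mul ?leq_pred.
exists J; split; last first.
  apply: leq_ltn_trans sJ _; rewrite size_r mulnC ltn_pmul2l // prednK //.
  exact: ltn_trans ltkV.
split=> [|x]; first by exists v.
have [->|neq_xs] := eqVneq x s; first by rewrite inE eqxx.
by apply: subJ; rewrite mem_rem_uniq ?enum_uniq // inE neq_xs mem_enum.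
Qed.
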